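(* Let $0<q<1$ and let $a,b,c,d,r,s,t,h,z,\beta,\delta$ be complex numbers with $\max\{|a|,|b|,|c|,|d|,|r|,|s|,|t|,|h|,|z|\}<1$. Put $\alpha=a^2bcdr/q$. Then \begin{align*} &\sum_{n=0}^\infty \frac{(\beta, \delta, ab, ac, ad, ar; q)_n (bcdrz)^n}{(q, s, t, h, abcd, abcr; q)_n}\, {}_3\phi_2\left({{abq^{n}, acq^{n}, bc}\atop{abcdq^n, abcrq^n}}; q, dr\right)\\ &=\frac{(abdr, acdr; q)_\infty}{(dr, q\alpha; q)_\infty} \sum_{n=0}^\infty \frac{(1-\alpha q^{2n})(\alpha, ab, ac, ad, ar; q)_n}{(1-\alpha)(q, abcd, abcr, abdr, acdr; q)_n}(-bcdr)^n q^{n(n-1)/2}\, {}_4\phi_3\left({{q^{-n}, \alpha q^{n}, \beta, \delta}\atop{s, t, h}}; q, qz\right). \end{align*} The identity also holds when $|z|=1$, provided the series on the right-hand side converges absolutely for $|z|=1$.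
   Context: For $0<q<1$: $(a;q)_0=1$, $(a;q)_n=\prod_{k=0}^{n-1}(1-aq^k)$, $(a;q)_\infty=\prod_{k=0}^\infty(1-aq^k)$, and $(a_1,\dots,a_m;q)_n=(a_1;q)_n\cdots(a_m;q)_n$ (also for $n=\infty$). The basic hypergeometric series is ${}_{r+1}\phi_r\left({{a_1,\dots,a_{r+1}}\atop{b_1,\dots,b_r}};q,z\right)=\sum_{n\ge0}\frac{(a_1,\dots,a_{r+1};q)_n}{(q,b_1,\dots,b_r;q)_n}z^n$. *)

(* Defs.v *)
From Stdlib Require Export Reals List.
From Coquelicot Require Export Coquelicot.
Export ListNotations.

#[global] Open Scope R_scope.
#[global] Open Scope C_scope.

(* Total limit and sum of complex sequences, taken componentwise since
   [Lim_seq] and [Series] are real-valued; meaningful only in case of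
   convergence. *)
Definition CLim (u : nat -> C) : C :=
  (real (Lim_seq (fun n => Re (u n))), real (Lim_seq (fun n => Im (u n)))).

Definition CSeries (u : nat -> C) : C :=
  (Series (fun n => Re (u n)), Series (fun n => Im (u n))).

Fixpoint qpoch (a q : C) (n : nat) : C :=
  match n with
  | O => 1
  | S k => qpoch a q k * (1 - a * q ^ k)
  end.

Definition qpoch_inf (a q : C) : C := CLim (qpoch a q).

Definition qpochs (l : list C) (q : C) (n : nat) : C :=
  fold_right (fun a p => qpoch a q n * p) 1 l.

Definition qpochs_inf (l : list C) (q : C) : C :=
  fold_right (fun a p => qpoch_inf a q * p) 1 l.

(* The series (r+1)-phi-r: [num] is meant to have exactly one more entry than
   [den]; for other lengths the usual definition carries an extra factor. *)
Definition qhyp_term (num den : list C) (q z : C) (n : nat) : C :=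
  qpochs num q n / qpochs (q :: den) q n * z ^ n.

Definition qhyp (num den : list C) (q z : C) : C :=
  CSeries (qhyp_term num den q z).

Definition lhs_term (q a b c d r s t h z beta delta : C) (n : nat) : C :=
  qpochs [beta; delta; a * b; a * c; a * d; a * r] q n
    * (b * c * d * r * z) ^ n
    / qpochs [q; s; t; h; a * b * c * d; a * b * c * r] q n
    * qhyp [a * b * q ^ n; a * c * q ^ n; b * c]
           [a * b * c * d * q ^ n; a * b * c * r * q ^ n] q (d * r).

Definition rhs_term (q a b c d r s t h z beta delta alpha : C) (n : nat) : C :=
  (1 - alpha * q ^ (2 * n)) * qpochs [alpha; a * b; a * c; a * d; a * r] q n
    / ((1 - alpha)
       * qpochs [q; a * b * c * d; a * b * c * r; a * b * d * r; a * c * d * r]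
           q n)
    * (- (b * c * d * r)) ^ n * q ^ (n * (n - 1) / 2)
    * qhyp [/ q ^ n; alpha * q ^ n; beta; delta] [s; t; h] q (q * z).

(* Main.v *)
(** Write the right-hand 4-phi-3 as a sum over [k] and interchange it with the sum
    over [n = k + m].  The double series is dominated by a multiple of
    [|bcdr| ^ (k + m)] whenever [|z| <= 1].  The inner sum over [m] is
    very-well-poised, with [a q^k] in place of [a], and is evaluated by the
    nonterminating limit of Watson's transformation, which produces the 3-phi-2 on
    the left.

    The limit of Watson's transformation comes from the same interchange: by the
    q-Pfaff-Saalschuetz sum, [(bc)^n (ad, ar)_n / (abcr, abcd)_n] is a terminating
    sum over [j], and after the interchange the inner sums are limits of
    very-well-poised 6-phi-5 series.  Both summation formulas follow from
    telescoping recurrences: in [n] for the former, and under [x -> x q] for the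
    latter. *)

Require Import Defs.
From Stdlib Require Import Lra Lia.

(** * Limits and series of complex numbers *)

Lemma Cminus_nz (u v : C) : u <> v -> v - u <> 0.
Proof.
intros Huv E. apply Huv. replace u with (v - (v - u)) by ring. rewrite E. ring.
Qed.

Lemma Cinv_nz (u : C) : u <> 0 -> / u <> 0.
Proof.
intros Hu E. apply C1_nz. rewrite <- (Cinv_r u Hu), E. ring.
Qed.

Lemma Cmult_cancel_l (c u v : C) : c <> 0 -> c * u = c * v -> u = v.
Proof.
intros Hc E. replace u with (/ c * (c * u)) by (field; exact Hc).
rewrite E. field. exact Hc.
Qed.

(** Phrased through a real limit, so that squeezing and the arithmetic of real limits carry over
    directly. *)
Definition Cconv (u : nat -> C) (l : C) : Prop :=
  is_lim_seq (fun n => Cmod (u n - l)) 0.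

(** Bridges to the filters behind [is_series]. Balls of [C] are componentwise boxes, comparable with
    discs up to a factor [sqrt 2]. *)
Lemma Cconv_filterlim (u : nat -> C) (l : C) :
  Cconv u l <-> filterlim u eventually (locally l).
Proof.
split; intros H.
- apply (filterlim_locally (F := eventually) u l). intros eps.
  apply is_lim_seq_spec in H. destruct (H eps) as [N HN].
  exists N; intros n Hn. apply C_NormedModule_mixin_compat1.
  specialize (HN n Hn). rewrite Rminus_0_r, Rabs_pos_eq in HN by apply Cmod_ge_0.
  exact HN.
- apply is_lim_seq_spec. intros eps.
  assert (He : 0 < eps / sqrt 2).
  { apply Rdiv_lt_0_compat; [apply cond_pos | apply Rlt_sqrt2_0]. }
  destruct (proj1 (filterlim_locally (F := eventually) u l) H (mkposreal _ He))
    as [N HN].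
  exists N; intros n Hn. specialize (HN n Hn).
  apply C_NormedModule_mixin_compat2 in HN. simpl in HN.
  rewrite Rminus_0_r, Rabs_pos_eq by apply Cmod_ge_0.
  replace (pos eps) with (sqrt 2 * (eps / sqrt 2))%R; [exact HN|].
  field. apply Rgt_not_eq, Rlt_sqrt2_0.
Qed.

Lemma Cconv_ext (u v : nat -> C) (l : C) :
  (forall n, u n = v n) -> Cconv u l -> Cconv v l.
Proof.
intros E. apply is_lim_seq_ext. intros n; now rewrite E.
Qed.

Lemma Cconv_squeeze (u : nat -> C) (l : C) (v : nat -> R) :
  (forall n, (Cmod (u n - l) <= v n)%R) -> is_lim_seq v 0 -> Cconv u l.
Proof.
intros E H. apply is_lim_seq_le_le with (fun _ => 0%R) v; trivial.
- intros n; split; [apply Cmod_ge_0 | apply E].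
- apply is_lim_seq_const.
Qed.

Lemma Cconv_unique (u : nat -> C) (l l' : C) :
  Cconv u l -> Cconv u l' -> l = l'.
Proof.
intros H H'.
assert (K : is_lim_seq (fun _ : nat => Cmod (l - l')) 0).
{ apply is_lim_seq_le_le
    with (fun _ => 0%R) (fun n => (Cmod (u n - l) + Cmod (u n - l'))%R).
  - intros n; split; [apply Cmod_ge_0|].
    replace (l - l') with (- (u n - l) + (u n - l')) by ring.
    eapply Rle_trans; [apply Cmod_triangle|]. rewrite Cmod_opp. lra.
  - apply is_lim_seq_const.
  - replace 0%R with (0 + 0)%R by ring. now apply is_lim_seq_plus'. }
assert (K0 := is_lim_seq_const (Cmod (l - l'))).
assert (E := is_lim_seq_unique _ _ K). rewrite (is_lim_seq_unique _ _ K0) in E.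
injection E as E. apply Cmod_eq_0 in E.
replace l with ((l - l') + l') by ring. rewrite E; ring.
Qed.

Lemma Cconv_const (c : C) : Cconv (fun _ => c) c.
Proof.
apply Cconv_squeeze with (fun _ => 0%R); [|apply is_lim_seq_const].
intros n. replace (c - c) with (RtoC 0) by ring. rewrite Cmod_0; lra.
Qed.

Lemma Cconv_mult (u v : nat -> C) (l l' : C) :
  Cconv u l -> Cconv v l' -> Cconv (fun n => u n * v n) (l * l').
Proof.
intros Hu Hv.
apply Cconv_squeeze with (fun n => Cmod (u n - l) * Cmod (v n - l')
   + (Cmod l * Cmod (v n - l') + Cmod (u n - l) * Cmod l'))%R.
- intros n.
  replace (u n * v n - l * l') with
    ((u n - l) * (v n - l') + (l * (v n - l') + (u n - l) * l')) by ring.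
  eapply Rle_trans; [apply Cmod_triangle|]. rewrite Cmod_mult.
  apply Rplus_le_compat_l.
  eapply Rle_trans; [apply Cmod_triangle|]. rewrite !Cmod_mult. lra.
- replace 0%R with (0 * 0 + (Cmod l * 0 + 0 * Cmod l'))%R by ring.
  apply is_lim_seq_plus'; [now apply is_lim_seq_mult'|].
  apply is_lim_seq_plus'; apply is_lim_seq_mult'; trivial;
    apply is_lim_seq_const.
Qed.

Lemma Cconv_incr (u : nat -> C) (l : C) (k : nat) :
  Cconv u l -> Cconv (fun n => u (n + k)%nat) l.
Proof.
intros H. exact (proj1 (is_lim_seq_incr_n (fun n => Cmod (u n - l)) k 0) H).
Qed.

(** Serves to keep an infinite product away from 0; it follows from
    [m <= Cmod l + Cmod (u n - l)]. *)
Lemma Cconv_ge (u : nat -> C) (l : C) (m : R) :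
  Cconv u l -> (forall n, (m <= Cmod (u n))%R) -> (m <= Cmod l)%R.
Proof.
intros H Hm.
assert (K : Rbar_le m (Cmod l + 0)%R).
{ apply is_lim_seq_le with (fun _ => m) (fun n => Cmod l + Cmod (u n - l))%R.
  - intros n. eapply Rle_trans; [apply Hm|].
    replace (u n) with (l + (u n - l)) at 1 by ring. apply Cmod_triangle.
  - apply is_lim_seq_const.
  - apply is_lim_seq_plus'; [apply is_lim_seq_const | exact H]. }
simpl in K. lra.
Qed.

Lemma Cmod_le_abs (x : C) : (Rabs (fst x) <= Cmod x)%R /\ (Rabs (snd x) <= Cmod x)%R.
Proof.
assert (H := Rmax_Cmod x).
split; (eapply Rle_trans; [|exact H]); [apply Rmax_l | apply Rmax_r].
Qed.

Lemma Cconv_components (u : nat -> C) (l : C) :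
  Cconv u l -> is_lim_seq (fun n => Re (u n)) (Re l)
               /\ is_lim_seq (fun n => Im (u n)) (Im l).
Proof.
intros H.
(* Both parts are treated at once: [p] is any subtractive map dominated by the modulus. *)
assert (K : forall p : C -> R, (forall x y : C, p (x - y)%C = (p x - p y)%R) ->
    (forall x, (Rabs (p x) <= Cmod x)%R) ->
    is_lim_seq (fun n => p (u n)) (p l)).
{ intros p Hp Hb.
  apply is_lim_seq_ext with (fun n => (p (u n - l)%C + p l)%R).
  { intros n; rewrite Hp; ring. }
  replace (Finite (p l)) with (Finite (0 + p l)) by (f_equal; ring).
  apply is_lim_seq_plus'; [|apply is_lim_seq_const].
  apply is_lim_seq_abs_0.
  apply is_lim_seq_le_le with (fun _ => 0%R) (fun n => Cmod (u n - l)); trivial.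
  - intros n; split; [apply Rabs_pos | apply Hb].
  - apply is_lim_seq_const. }
split; apply K; intros; try reflexivity; apply Cmod_le_abs.
Qed.

Lemma CLim_correct (u : nat -> C) (l : C) : Cconv u l -> CLim u = l.
Proof.
intros H. apply Cconv_components in H. destruct H as [H1 H2]. unfold CLim.
rewrite (is_lim_seq_unique _ _ H1), (is_lim_seq_unique _ _ H2).
now destruct l.
Qed.

(** * Finite sums and series, restated with the operations of [C] *)

Lemma Csum_0 (a : nat -> C) : sum_n a 0 = a 0%nat :> C.
Proof. exact (sum_O a). Qed.

Lemma Csum_S (a : nat -> C) (n : nat) : sum_n a (S n) = sum_n a n + a (S n) :> C.
Proof. exact (sum_Sn a n). Qed.

Lemma Csum_scal (c : C) (a : nat -> C) (n : nat) :
  sum_n (fun k => c * a k) n = c * sum_n a n :> C.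
Proof. exact (sum_n_mult_l (K := C_Ring) c a n). Qed.

Lemma Csum_minus (a b : nat -> C) (n : nat) :
  sum_n (fun k => a k - b k) n = sum_n a n - sum_n b n :> C.
Proof.
induction n as [|n IH]; [now rewrite !Csum_0|].
rewrite !Csum_S, IH. ring.
Qed.

Lemma Csum_ext (a b : nat -> C) (n : nat) :
  (forall k, (k <= n)%nat -> a k = b k) -> sum_n a n = sum_n b n :> C.
Proof. exact (sum_n_ext_loc a b n). Qed.

Lemma Csum_Cmod (a : nat -> C) (n : nat) :
  (Cmod (sum_n a n) <= sum_n (fun k => Cmod (a k)) n)%R.
Proof.
induction n as [|n IH]; [rewrite Csum_0, sum_O; apply Rle_refl|].
rewrite Csum_S, sum_Sn. eapply Rle_trans; [apply Cmod_triangle|].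
apply Rplus_le_compat_r, IH.
Qed.

Lemma is_series_Cconv (a : nat -> C) (l : C) :
  is_series a l <-> Cconv (fun n => sum_n a n) l.
Proof. symmetry. apply Cconv_filterlim. Qed.

Lemma Cseries_ext (a b : nat -> C) (l : C) :
  (forall n, a n = b n) -> is_series a l -> is_series b l.
Proof. exact (is_series_ext a b l). Qed.

Lemma Cseries_unique (a : nat -> C) (l l' : C) :
  is_series a l -> is_series a l' -> l = l'.
Proof.
intros H H'. apply is_series_Cconv in H. apply is_series_Cconv in H'.
exact (Cconv_unique _ _ _ H H').
Qed.

Lemma Cseries_scal (c : C) (a : nat -> C) (l : C) :
  is_series a l -> is_series (fun n => c * a n) (c * l).
Proof. exact (is_series_scal c a l). Qed.

Lemma CSeries_correct (a : nat -> C) (l : C) : is_series a l -> CSeries a = l.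
Proof.
intros H. apply is_series_Cconv, Cconv_components in H. destruct H as [H1 H2].
assert (E : forall n, Re (sum_n a n) = sum_n (fun k => Re (a k)) n
                      /\ Im (sum_n a n) = sum_n (fun k => Im (a k)) n).
{ induction n as [|n [IH1 IH2]]; [now rewrite Csum_0, !sum_O|].
  rewrite Csum_S, !sum_Sn, <- IH1, <- IH2. now split. }
unfold CSeries.
rewrite (is_series_unique _ (Re l)), (is_series_unique _ (Im l)).
- now destruct l.
- exact (is_lim_seq_ext _ _ _ (fun n => proj2 (E n)) H2).
- exact (is_lim_seq_ext _ _ _ (fun n => proj1 (E n)) H1).
Qed.

Lemma CSeries_finite (a : nat -> C) (n : nat) :
  (forall k, (n < k)%nat -> a k = 0) -> CSeries a = sum_n a n.
Proof.
intros H. apply CSeries_correct, is_series_Cconv.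
assert (E : forall m, sum_n a (m + n)%nat = sum_n a n :> C).
{ induction m as [|m IH]; [reflexivity|].
  simpl. rewrite Csum_S, IH, H by lia. ring. }
apply (is_lim_seq_incr_n _ n).
apply is_lim_seq_ext with (fun _ => 0%R); [|apply is_lim_seq_const].
intros m. rewrite E. replace (_ - _) with (RtoC 0) by ring. now rewrite Cmod_0.
Qed.

(** Comparison with a geometric series. The explicit tail bound drives both the interchange of
    summations and the limit at [x = 0] in [six_phi_five]. *)
Lemma Cseries_geom_bound (a : nat -> C) (B rho : R) :
  (0 <= rho < 1)%R -> (forall n, (Cmod (a n) <= B * rho ^ n)%R) ->
  exists l, is_series a l /\
    forall n, (Cmod (l - sum_n a n) <= B * (/ (1 - rho) * rho ^ S n))%R.
Proof.
intros Hr Ha.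
assert (Hg : ex_series (fun n => B * rho ^ n)%R).
{ apply (ex_series_scal_l B (fun n => rho ^ n)%R). exists (/ (1 - rho))%R.
  apply is_series_geom. rewrite Rabs_pos_eq; lra. }
destruct (ex_series_le (V := C_CompleteNormedModule) a
            (fun n => B * rho ^ n)%R) as [l Hl]; [|exact Hg|].
{ intros n. change (norm (a n)) with (Cmod (a n)). apply Ha. }
exists l; split; [exact Hl|]. intros n.
apply is_series_Cconv in Hl.
assert (HB : (0 <= B)%R).
{ specialize (Ha 0%nat). simpl in Ha. assert (H := Cmod_ge_0 (a 0%nat)). lra. }
(* The exact geometric sum of the segment is kept, subtracted term included, so that the induction
   closes. *)
assert (Hfin : forall m, (Cmod (sum_n a (m + n) - sum_n a n)
                 <= B * (/ (1 - rho) * (rho ^ S n - rho ^ S (m + n))))%R).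
{ induction m as [|m IH].
  - simpl. replace (_ - _) with (RtoC 0) by ring. rewrite Cmod_0. apply Req_le. ring.
  - change (S m + n)%nat with (S (m + n)). rewrite Csum_S.
    replace (_ - _) with ((sum_n a (m + n)%nat - sum_n a n) + a (S (m + n)))
      by ring.
    eapply Rle_trans; [apply Cmod_triangle|].
    eapply Rle_trans; [apply Rplus_le_compat; [apply IH | apply Ha]|].
    apply Req_le. simpl. field. lra. }
assert (K : Rbar_le (Cmod (l - sum_n a n)) (0 + B * (/ (1 - rho) * rho ^ S n))%R).
{ apply is_lim_seq_le with (fun _ : nat => Cmod (l - sum_n a n))
   (fun m => Cmod (sum_n a (m + n)%nat - l)
             + B * (/ (1 - rho) * rho ^ S n))%R.
  - intros m.
    replace (l - sum_n a n)
      with (- (sum_n a (m + n)%nat - l) + (sum_n a (m + n)%nat - sum_n a n))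
      by ring.
    eapply Rle_trans; [apply Cmod_triangle|]. rewrite Cmod_opp.
    apply Rplus_le_compat_l. eapply Rle_trans; [apply Hfin|].
    apply Rmult_le_compat_l; [exact HB|].
    apply Rmult_le_compat_l; [left; apply Rinv_0_lt_compat; lra|].
    assert (0 <= rho ^ S (m + n))%R by (apply pow_le; lra). lra.
  - apply is_lim_seq_const.
  - apply is_lim_seq_plus'; [exact (Cconv_incr _ _ n Hl) | apply is_lim_seq_const]. }
simpl in K. simpl. lra.
Qed.

(** With [s = sqrt rho], one factor [s ^ n] absorbs the linear growth and the other tends to 0. *)
Lemma is_lim_seq_INR_geom (rho : R) :
  (0 <= rho < 1)%R -> is_lim_seq (fun n => INR (S n) * rho ^ n)%R 0.
Proof.
intros Hr. set (s := sqrt rho).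
assert (Hs0 : (0 <= s)%R) by apply sqrt_pos.
assert (Hss : (s * s = rho)%R) by (apply sqrt_sqrt; lra).
assert (Hs1 : (s < 1)%R) by nra.
assert (B : forall n, (INR (S n) * s ^ n * (1 - s) <= 1)%R).
(* The quotient of [1 - s ^ S n] by [1 - s] is a sum of [S n] powers, each at least [s ^ n]. *)
{ assert (B' : forall n, (INR (S n) * s ^ n * (1 - s) <= 1 - s ^ S n)%R).
  { induction n as [|n IH]; [simpl; lra|].
    rewrite S_INR. rewrite <- !tech_pow_Rmult in *.
    assert (0 <= s ^ n)%R by (apply pow_le; lra).
    assert (s * (INR (S n) * s ^ n * (1 - s)) <= s * (1 - s * s ^ n))%R
      by (apply Rmult_le_compat_l; lra).
    assert (s ^ n <= 1)%R by (rewrite <- (pow1 n); apply pow_incr; lra).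
    assert (s * s ^ n <= 1)%R by nra.
    assert (s * s ^ n * (1 - s) <= 1 * (1 - s))%R
      by (apply Rmult_le_compat_r; lra).
    lra. }
  intros n. specialize (B' n). assert (0 <= s ^ S n)%R by (apply pow_le; lra). lra. }
apply is_lim_seq_le_le with (fun _ => 0%R) (fun n => / (1 - s) * s ^ n)%R.
- intros n; split.
  + apply Rmult_le_pos; [apply pos_INR | apply pow_le; lra].
  + replace (rho ^ n)%R with (s ^ n * s ^ n)%R by (rewrite <- Hss; now rewrite Rpow_mult_distr).
    rewrite <- Rmult_assoc. apply Rmult_le_compat_r; [apply pow_le; lra|].
    specialize (B n). apply (Rmult_le_reg_r (1 - s)); [lra|].
    rewrite Rinv_l by lra. exact B.
- apply is_lim_seq_const.
- replace 0%R with (/ (1 - s) * 0)%R by ring.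
  apply is_lim_seq_mult'; [apply is_lim_seq_const|].
  apply is_lim_seq_geom. rewrite Rabs_pos_eq; lra.
Qed.

(** Two readings of a triangle of entries, by antidiagonals and by rows. Passing to [S N] adds one
    antidiagonal, that is, one entry to each old row and a new row of length one. *)
Lemma sum_antidiagonals (f : nat -> nat -> C) (N : nat) :
  sum_n (fun n => sum_n (fun k => f k (n - k)%nat) n) N
  = sum_n (fun k => sum_n (f k) (N - k)) N :> C.
Proof.
induction N as [|N IH]; [now rewrite !Csum_0|].
rewrite Csum_S, IH, !Csum_S.
(* The added entries are written as a difference with an opposite, to be split off by
   [Csum_minus]. *)
rewrite (Csum_ext (fun k => sum_n (f k) (S N - k)%nat)
           (fun k => sum_n (f k) (N - k)%nat - - f k (S N - k)%nat)).
- rewrite Csum_minus.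
  replace (sum_n (fun k => - f k (S N - k)%nat) N)
    with (- sum_n (fun k => f k (S N - k)%nat) N).
  + rewrite Nat.sub_diag, Csum_0. ring.
  + clear. induction N as [|N IH]; [now rewrite !Csum_0|].
    replace (- sum_n (fun k => f k (S (S N) - k)%nat) (S N))
      with ((- (1)) * sum_n (fun k => f k (S (S N) - k)%nat) (S N)) by ring.
    rewrite <- Csum_scal. apply Csum_ext. intros; ring.
- intros k Hk. replace (S N - k)%nat with (S (N - k)) by lia.
  rewrite Csum_S. ring.
Qed.

(** A triangular partial sum differs from the sum of the first [S N] rows by their tails only. Each
    tail is at most a constant times [rho ^ N], so together they are of order
    [INR (S N) * rho ^ N]. *)
Lemma Cseries_fubini (f : nat -> nat -> C) (g : nat -> C) (B rho : R) :
  (0 <= rho < 1)%R ->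
  (forall k m, (Cmod (f k m) <= B * (rho ^ k * rho ^ m))%R) ->
  (forall k, is_series (f k) (g k)) ->
  exists L, is_series g L /\
    is_series (fun n => sum_n (fun k => f k (n - k)%nat) n) L.
Proof.
intros Hr Hf Hg.
assert (HB : (0 <= B)%R).
{ specialize (Hf 0%nat 0%nat). simpl in Hf.
  assert (H := Cmod_ge_0 (f 0%nat 0%nat)). lra. }
assert (Hp : forall n, (0 <= rho ^ n)%R) by (intros; apply pow_le; lra).
assert (Hi : (0 <= / (1 - rho))%R) by (left; apply Rinv_0_lt_compat; lra).
assert (T : forall k m, (Cmod (g k - sum_n (f k) m)
              <= B * rho ^ k * (/ (1 - rho) * rho ^ S m))%R).
{ intros k m.
  destruct (Cseries_geom_bound (f k) (B * rho ^ k) rho Hr) as [l [Hl Hb]].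
  - intros n. eapply Rle_trans; [apply Hf|]. apply Req_le; ring.
  - rewrite (Cseries_unique _ _ _ (Hg k) Hl). apply Hb. }
(* A row sum is bounded by its first entry plus its tail, hence the constant
   [1 + / (1 - rho) * rho]. *)
destruct (Cseries_geom_bound g (B * (1 + / (1 - rho) * rho)) rho Hr)
  as [L [HL _]].
{ intros k. replace (g k) with (f k 0%nat + (g k - sum_n (f k) 0))
    by (rewrite Csum_0; ring).
  eapply Rle_trans; [apply Cmod_triangle|].
  eapply Rle_trans; [apply Rplus_le_compat; [apply Hf | apply T]|].
  apply Req_le. simpl. ring. }
exists L; split; [exact HL|]. apply is_series_Cconv.
apply is_series_Cconv in HL.
apply Cconv_squeeze with (fun N => Cmod (sum_n g N - L)
    + (B * / (1 - rho) * rho) * (INR (S N) * rho ^ N))%R.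
- intros N. rewrite sum_antidiagonals.
  replace (_ - L) with (- (sum_n g N - sum_n (fun k => sum_n (f k) (N - k)%nat) N)
     + (sum_n g N - L)) by ring.
  eapply Rle_trans; [apply Cmod_triangle|]. rewrite Cmod_opp, Rplus_comm.
  apply Rplus_le_compat_l. rewrite <- Csum_minus.
  eapply Rle_trans; [apply Csum_Cmod|].
  replace ((B * / (1 - rho) * rho) * (INR (S N) * rho ^ N))%R
    with (INR (S N) * (B * / (1 - rho) * rho * rho ^ N))%R by ring.
  rewrite <- sum_n_const.
  rewrite !sum_n_Reals. apply sum_Rle. intros k Hk.
  eapply Rle_trans; [apply T|]. apply Req_le.
  replace N with (k + (N - k))%nat at 2 by lia. rewrite pow_add. simpl. ring.
- replace 0%R with (0 + B * / (1 - rho) * rho * 0)%R by ring.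
  apply is_lim_seq_plus'; [exact HL|].
  apply is_lim_seq_mult'; [apply is_lim_seq_const|].
  now apply is_lim_seq_INR_geom.
Qed.

(** * q-shifted factorials *)

Definition bounded (w : nat -> C) : Prop :=
  exists B : R, forall n, (Cmod (w n) <= B)%R.

Lemma bounded_ext (u v : nat -> C) :
  (forall n, u n = v n) -> bounded u -> bounded v.
Proof. intros E [B HB]. exists B. intros n. rewrite <- E. apply HB. Qed.

Lemma bounded_const (c : C) : bounded (fun _ => c).
Proof. exists (Cmod c). intros _. apply Rle_refl. Qed.

Lemma bounded_S (w : nat -> C) : bounded w -> bounded (fun n => w (S n)).
Proof. intros [B HB]. exists B. auto. Qed.

Lemma bounded_mult (u v : nat -> C) :
  bounded u -> bounded v -> bounded (fun n => u n * v n).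
Proof.
intros [A HA] [B HB]. exists (A * B)%R. intros n. rewrite Cmod_mult.
apply Rmult_le_compat; trivial; apply Cmod_ge_0.
Qed.

Lemma bounded_pow (z : C) : (Cmod z <= 1)%R -> bounded (fun n => z ^ n).
Proof.
intros Hz. exists 1%R. intros n. rewrite Cmod_pow, <- (pow1 n).
apply pow_incr. split; [apply Cmod_ge_0 | exact Hz].
Qed.

Lemma Cconv_bounded_geom (w : nat -> C) (x : C) :
  bounded w -> (Cmod x < 1)%R -> Cconv (fun n => w n * x ^ n) 0.
Proof.
intros [B HB] Hx. apply Cconv_squeeze with (fun n => B * Cmod x ^ n)%R.
- intros n. replace (w n * x ^ n - 0) with (w n * x ^ n) by ring.
  rewrite Cmod_mult, Cmod_pow.
  apply Rmult_le_compat_r; [apply pow_le, Cmod_ge_0 | apply HB].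
- replace 0%R with (B * 0)%R by ring.
  apply is_lim_seq_mult'; [apply is_lim_seq_const|].
  apply is_lim_seq_geom. rewrite Rabs_pos_eq; [exact Hx | apply Cmod_ge_0].
Qed.

Lemma Cmod_mult_lt1 (u v : C) :
  (Cmod u < 1)%R -> (Cmod v <= 1)%R -> (Cmod (u * v) < 1)%R.
Proof.
intros Hu Hv. rewrite Cmod_mult.
assert (H := Cmod_ge_0 u). assert (H' := Cmod_ge_0 v). nra.
Qed.

Lemma Cmod_pow_le1 (q : C) (n : nat) : (Cmod q <= 1)%R -> (Cmod (q ^ n) <= 1)%R.
Proof.
intros Hq. rewrite Cmod_pow, <- (pow1 n). apply pow_incr.
split; [apply Cmod_ge_0 | exact Hq].
Qed.

Lemma one_minus_nz (u : C) : (Cmod u < 1)%R -> 1 - u <> 0.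
Proof. intros Hu. apply Cminus_nz. intros ->. rewrite Cmod_1 in Hu. lra. Qed.

Lemma qpoch_S (u q : C) (n : nat) :
  qpoch u q (S n) = qpoch u q n * (1 - u * q ^ n).
Proof. reflexivity. Qed.

Lemma qpoch_add (u q : C) (k n : nat) :
  qpoch u q (k + n) = qpoch u q k * qpoch (u * q ^ k) q n.
Proof.
induction n as [|n IH].
- rewrite Nat.add_0_r. simpl. ring.
- rewrite Nat.add_succ_r, !qpoch_S, IH, Cpow_add_r. ring.
Qed.

Lemma qpoch_S_l (u q : C) (n : nat) :
  qpoch u q (S n) = (1 - u) * qpoch (u * q) q n.
Proof.
change (S n) with (1 + n)%nat. rewrite qpoch_add. simpl. rewrite !Cmult_1_r.
ring.
Qed.

Lemma qpoch_nz (u q : C) (n : nat) :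
  (Cmod q <= 1)%R -> (Cmod u < 1)%R -> qpoch u q n <> 0.
Proof.
intros Hq Hu. induction n as [|n IH].
- exact C1_nz.
- apply Cmult_neq_0; [exact IH|]. apply one_minus_nz, Cmod_mult_lt1; trivial.
  now apply Cmod_pow_le1.
Qed.

(** By [1 + x <= exp x], the exponents add up to a geometric sum. Only the growth of [p] is
    constrained, so that q-shifted factorials and their inverses are both covered. *)
Lemma prod_exp_bound (p : nat -> R) (A rho : R) :
  (0 <= A)%R -> (0 <= rho < 1)%R -> (0 <= p 0%nat <= 1)%R ->
  (forall n, (0 <= p n -> 0 <= p (S n) <= p n * (1 + A * rho ^ n))%R) ->
  forall n, (p n <= exp (A / (1 - rho)))%R.
Proof.
intros HA Hr H0 HS.
assert (K : forall n, (0 <= p n <= exp (A / (1 - rho) * (1 - rho ^ n)))%R).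
{ induction n as [|n [IH0 IH]].
  - simpl. rewrite Rminus_diag, Rmult_0_r, exp_0. exact H0.
  - destruct (HS n IH0) as [P Q]. split; [exact P|].
    eapply Rle_trans; [exact Q|].
    replace (A / (1 - rho) * (1 - rho ^ S n))%R
      with (A / (1 - rho) * (1 - rho ^ n) + A * rho ^ n)%R
      by (simpl; field; lra).
    rewrite exp_plus.
    assert (0 <= A * rho ^ n)%R by (apply Rmult_le_pos; [lra | apply pow_le; lra]).
    apply Rmult_le_compat; try lra. apply exp_ineq1_le. }
intros n. eapply Rle_trans; [apply K|].
assert (0 <= A / (1 - rho))%R by (apply Rle_mult_inv_pos; lra).
assert (0 <= rho ^ n)%R by (apply pow_le; lra).
assert (A / (1 - rho) * (1 - rho ^ n) <= A / (1 - rho))%R by nra.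
destruct H2 as [H2|H2]; [left; now apply exp_increasing | rewrite H2; apply Rle_refl].
Qed.

(** The bound is uniform in [u] as well as in [n]: parameters later vary along [x * q ^ N]. *)
Lemma qpoch_bound (q : C) (A : R) :
  (Cmod q < 1)%R -> (0 <= A)%R ->
  exists B : R, forall u n, (Cmod u <= A)%R -> (Cmod (qpoch u q n) <= B)%R.
Proof.
intros Hq HA. exists (exp (A / (1 - Cmod q))). intros u n Hu.
apply (prod_exp_bound (fun n => Cmod (qpoch u q n))); trivial.
- split; [apply Cmod_ge_0 | exact Hq].
- simpl. rewrite Cmod_1. lra.
- intros m Hm. split; [apply Cmod_ge_0|]. rewrite qpoch_S, Cmod_mult.
  apply Rmult_le_compat_l; [exact Hm|].
  unfold Cminus. eapply Rle_trans; [apply Cmod_triangle|].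
  rewrite Cmod_1, Cmod_opp, Cmod_mult, Cmod_pow.
  apply Rplus_le_compat_l, Rmult_le_compat_r; [apply pow_le, Cmod_ge_0 | exact Hu].
Qed.

(** With [w = rho * Cmod q ^ m], a new factor is at most [/ (1 - w) = 1 + w / (1 - w) <= 1 + w / (1
    - rho)], the shape required by [prod_exp_bound]. *)
Lemma qpoch_inv_bound (q : C) (rho : R) :
  (Cmod q < 1)%R -> (0 <= rho < 1)%R ->
  exists B : R, forall u n, (Cmod u <= rho)%R -> (Cmod (/ qpoch u q n) <= B)%R.
Proof.
intros Hq Hr. exists (exp (rho / (1 - rho) / (1 - Cmod q))). intros u n Hu.
assert (Hq0 := Cmod_ge_0 q).
apply (prod_exp_bound (fun n => Cmod (/ qpoch u q n))).
- apply Rle_mult_inv_pos; lra.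
- lra.
- simpl. rewrite Cmod_inv, Cmod_1 by apply C1_nz. lra.
- intros m Hm. split; [apply Cmod_ge_0|].
  assert (Hp : (0 <= Cmod q ^ m <= 1)%R).
  { split; [now apply pow_le|]. rewrite <- (pow1 m). apply pow_incr. lra. }
  assert (Hn : 1 - u * q ^ m <> 0).
  { apply one_minus_nz, Cmod_mult_lt1; [lra|]. apply Cmod_pow_le1; lra. }
  assert (Hm' : qpoch u q m <> 0) by (apply qpoch_nz; lra).
  replace (/ qpoch u q (S m)) with (/ qpoch u q m * / (1 - u * q ^ m))
    by (rewrite qpoch_S; field; now split).
  rewrite Cmod_mult. apply Rmult_le_compat_l; [exact Hm|].
  rewrite Cmod_inv by exact Hn.
  set (w := (rho * Cmod q ^ m)%R).
  assert (Hw : (0 <= w <= rho)%R) by (unfold w; nra).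
  assert (L : (1 - w <= Cmod (1 - u * q ^ m))%R).
  { assert (T := Cmod_triangle (1 - u * q ^ m) (u * q ^ m)).
    replace (1 - u * q ^ m + u * q ^ m) with (RtoC 1) in T by ring.
    rewrite Cmod_1, (Cmod_mult u), Cmod_pow in T.
    assert (Cmod u * Cmod q ^ m <= w)%R by (apply Rmult_le_compat_r; lra). lra. }
  apply Rle_trans with (/ (1 - w))%R.
  { apply Rinv_le_contravar; lra. }
  replace (rho / (1 - rho) * Cmod q ^ m)%R with (w / (1 - rho))%R
    by (unfold w; field; lra).
  replace (/ (1 - w))%R with (1 + w * / (1 - w))%R by (field; lra).
  apply Rplus_le_compat_l, Rmult_le_compat_l; [lra|].
  apply Rinv_le_contravar; lra.
Qed.

Lemma bounded_qpoch (q u : C) : (Cmod q < 1)%R -> bounded (qpoch u q).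
Proof.
intros Hq. destruct (qpoch_bound q (Cmod u) Hq (Cmod_ge_0 u)) as [B HB].
exists B. intros n. apply HB, Rle_refl.
Qed.

Lemma bounded_qpoch_inv (q u : C) :
  (Cmod q < 1)%R -> (Cmod u < 1)%R -> bounded (fun n => / qpoch u q n).
Proof.
intros Hq Hu.
destruct (qpoch_inv_bound q (Cmod u) Hq (conj (Cmod_ge_0 u) Hu)) as [B HB].
exists B. intros n. apply HB, Rle_refl.
Qed.

(** The partial products are partial sums of their increments [- (qpoch u q n * (u * q ^ n))], which
    decay geometrically. *)
Lemma qpoch_inf_conv (q u : C) :
  (Cmod q < 1)%R -> Cconv (qpoch u q) (qpoch_inf u q).
Proof.
intros Hq. destruct (bounded_qpoch q u Hq) as [B HB].
destruct (Cseries_geom_bound (fun n => - (qpoch u q n * (u * q ^ n)))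
            (B * Cmod u) (Cmod q)) as [l [Hl _]].
- split; [apply Cmod_ge_0 | exact Hq].
- intros n. rewrite Cmod_opp, !Cmod_mult, Cmod_pow, <- Rmult_assoc.
  repeat apply Rmult_le_compat_r; try apply pow_le; try apply Cmod_ge_0.
  apply HB.
- apply is_series_Cconv in Hl.
  assert (E : forall n, sum_n (fun n => - (qpoch u q n * (u * q ^ n))) n
                        = qpoch u q (S n) - 1 :> C).
  { induction n as [|n IH]; [rewrite Csum_0; simpl; ring|].
    rewrite Csum_S, IH, !qpoch_S. ring. }
  assert (K : Cconv (qpoch u q) (1 + l)).
  { apply is_lim_seq_incr_1. revert Hl. apply is_lim_seq_ext.
    intros n. rewrite E. f_equal. ring. }
  unfold qpoch_inf. now rewrite (CLim_correct _ _ K).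
Qed.

(** A bound [B] on the inverses keeps the partial products, hence their limit, at modulus at least
    [/ B]. *)
Lemma qpoch_inf_nz (q u : C) :
  (Cmod q < 1)%R -> (Cmod u < 1)%R -> qpoch_inf u q <> 0.
Proof.
intros Hq Hu.
destruct (bounded_qpoch_inv q u Hq Hu) as [B HB].
assert (P : forall n, (0 < Cmod (qpoch u q n))%R).
{ intros n. apply Cmod_gt_0, qpoch_nz; lra. }
assert (HB0 : (0 < B)%R).
{ eapply Rlt_le_trans; [|apply (HB 0%nat)].
  apply Cmod_gt_0. simpl. replace (/ 1) with (RtoC 1) by field. exact C1_nz. }
apply Cmod_gt_0. apply Rlt_le_trans with (/ B)%R; [now apply Rinv_0_lt_compat|].
apply (Cconv_ge (qpoch u q)); [now apply qpoch_inf_conv|].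
intros n. specialize (HB n). rewrite Cmod_inv in HB by (apply qpoch_nz; lra).
rewrite <- (Rinv_inv (Cmod (qpoch u q n))). apply Rinv_le_contravar; trivial.
apply Rinv_0_lt_compat, P.
Qed.

Lemma qpoch_inf_shift (q u : C) (k : nat) :
  (Cmod q < 1)%R -> qpoch_inf u q = qpoch u q k * qpoch_inf (u * q ^ k) q.
Proof.
intros Hq.
apply Cconv_unique with (fun n => qpoch u q (n + k)%nat).
- apply Cconv_incr. now apply qpoch_inf_conv.
- apply Cconv_ext with (fun n => qpoch u q k * qpoch (u * q ^ k) q n).
  + intros n. now rewrite Nat.add_comm, qpoch_add.
  + apply Cconv_mult; [apply Cconv_const | now apply qpoch_inf_conv].
Qed.

(** * Terminating factors and reversal of products *)

Lemma qpoch_inv_pow_0 (q : C) (m : nat) : q <> 0 -> qpoch (/ q ^ m) q (S m) = 0.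
Proof.
intros Hq. rewrite qpoch_S, Cinv_l; [ring | now apply Cpow_nz].
Qed.

Lemma qpoch_inv_pow_eq0 (q : C) (n k : nat) :
  q <> 0 -> (n < k)%nat -> qpoch (/ q ^ n) q k = 0.
Proof.
intros Hq Hk. replace k with (S n + (k - S n))%nat by lia.
rewrite qpoch_add, qpoch_inv_pow_0 by exact Hq. ring.
Qed.

Lemma triangular_S (n : nat) :
  (S n * (S n - 1) / 2 = n * (n - 1) / 2 + n)%nat.
Proof.
rewrite <- Nat.div_add by discriminate.
now replace (S n * (S n - 1))%nat with (n * (n - 1) + n * 2)%nat by nia.
Qed.

(** The classical expression of $(q^{-n};q)_k$ by $(q;q)_n/(q;q)_{n-k}$ at [n = k + m], with
    denominators cleared. The triangular powers of [n] and [m] absorb the negative powers of [q]. *)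
Lemma qpoch_reversal (q : C) (k m : nat) :
  q <> 0 ->
  qpoch (/ q ^ (k + m)) q k * q ^ k * (- (1)) ^ k * q ^ ((k + m) * (k + m - 1) / 2)
    * qpoch q q m
  = qpoch q q (k + m) * q ^ (m * (m - 1) / 2).
Proof.
intros Hq. induction k as [|k IH]; [simpl; ring|].
change (S k + m)%nat with (S (k + m)).
rewrite triangular_S, qpoch_S_l, (qpoch_S q), Cpow_add_r, !Cpow_S.
assert (Hn := Cpow_nz q (k + m) Hq).
(* Peeling off the first factor turns the base for [S k + m] into that for [k + m]. *)
replace (/ (q * q ^ (k + m)) * q) with (/ q ^ (k + m)) by (field; now split).
transitivity ((1 - q * q ^ (k + m)) * (qpoch (/ q ^ (k + m)) q k * q ^ k
   * (- (1)) ^ k * q ^ ((k + m) * (k + m - 1) / 2) * qpoch q q m)).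
- field; now split.
- rewrite IH. ring.
Qed.

(** * Interchange of summations *)

(* The very-well-poised factor of a summand; [alpha = 1], where division would
   give the junk value [0], is excluded wherever it is used. *)
Definition vwp (alpha q : C) (n : nat) : C :=
  (1 - alpha * q ^ (2 * n)) * qpoch alpha q n / ((1 - alpha) * qpoch q q n).

(** The factor [qpoch (alpha * q) q (2 * k)] trades the denominator [1 - alpha * q ^ (2 * k)] for
    [1 - alpha], which makes bounds uniform in [k]. *)
Lemma vwp_shift (alpha q : C) (k m : nat) :
  (Cmod q < 1)%R -> alpha <> 1 -> alpha * q ^ (2 * k) <> 1 ->
  qpoch (alpha * q) q (2 * k) * vwp (alpha * q ^ (2 * k)) q m
  = (1 - alpha * q ^ (2 * (k + m))) * qpoch alpha q (2 * k + m)
    / ((1 - alpha) * qpoch q q m).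
Proof.
intros Hq H1 H2. unfold vwp.
assert (H1' : 1 - alpha <> 0) by (now apply Cminus_nz).
assert (H2' : 1 - alpha * q ^ (2 * k) <> 0)
  by (now apply Cminus_nz).
assert (Hqq : qpoch q q m <> 0) by (apply qpoch_nz; lra).
assert (E : (1 - alpha) * qpoch (alpha * q) q (2 * k)
            = qpoch alpha q (2 * k) * (1 - alpha * q ^ (2 * k))).
{ now rewrite <- qpoch_S_l, qpoch_S. }
rewrite qpoch_add.
replace (2 * (k + m))%nat with (2 * k + 2 * m)%nat by ring.
rewrite Cpow_add_r.
apply (Cmult_cancel_l (1 - alpha)); [exact H1'|].
transitivity (((1 - alpha) * qpoch (alpha * q) q (2 * k)) *
  ((1 - alpha * q ^ (2 * k) * q ^ (2 * m)) * qpoch (alpha * q ^ (2 * k)) q m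
    / ((1 - alpha * q ^ (2 * k)) * qpoch q q m))).
- ring.
- rewrite E. field. now repeat split.
Qed.

(* Interchanging summations: [qpoch (/ q ^ n) q k] vanishes for [n < k], and
   dividing it by [qpoch q q n] leaves [/ qpoch q q (n - k)] up to powers, so that
   the sum over [n = k + m] is again very-well-poised, with base
   [alpha * q ^ (2 * k)]. *)
Lemma bailey_transform (q alpha x : C) (w g J : nat -> C) :
  q <> 0 -> (Cmod q < 1)%R -> (Cmod x < 1)%R ->
  (forall k, alpha * q ^ (2 * k) <> 1) -> bounded w -> bounded g ->
  (forall k, is_series (fun m => vwp (alpha * q ^ (2 * k)) q m * w (k + m)%nat
                * (- x) ^ m * q ^ (m * (m - 1) / 2)) (J k)) ->
  exists L,
    is_series (fun k => g k * x ^ k * qpoch (alpha * q) q (2 * k) * J k) L /\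
    is_series (fun n => vwp alpha q n * w n * (- x) ^ n * q ^ (n * (n - 1) / 2)
      * sum_n (fun k => qpoch (/ q ^ n) q k * qpoch (alpha * q ^ n) q k
                        * g k * q ^ k) n) L.
Proof.
intros Hq0 Hq Hx Ha [Bw HBw] [Bg HBg] HJ.
assert (Ha0 : alpha <> 1).
{ specialize (Ha 0%nat). simpl in Ha. now rewrite Cmult_1_r in Ha. }
assert (Ha0' : 1 - alpha <> 0)
  by (now apply Cminus_nz).
destruct (bounded_qpoch q alpha Hq) as [Ba HBa].
destruct (bounded_qpoch_inv q q Hq Hq) as [Bq HBq].
(* Row [k] sums to the [k]-th term of the first series; the antidiagonal [k + m = n] will be the
   [n]-th term of the second. *)
set (f := fun k m => g k * x ^ k * qpoch (alpha * q) q (2 * k)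
   * (vwp (alpha * q ^ (2 * k)) q m * w (k + m)%nat
                * (- x) ^ m * q ^ (m * (m - 1) / 2))).
assert (Ef : forall k m, f k m = g k * x ^ k * (- x) ^ m * q ^ (m * (m - 1) / 2)
   * w (k + m)%nat * (1 - alpha * q ^ (2 * (k + m))) * qpoch alpha q (2 * k + m)
   * / (1 - alpha) * / qpoch q q m).
{ intros k m. unfold f.
  transitivity (g k * x ^ k * (- x) ^ m * q ^ (m * (m - 1) / 2)
   * w (k + m)%nat
   * (qpoch (alpha * q) q (2 * k) * vwp (alpha * q ^ (2 * k)) q m)).
  - ring.
  - rewrite vwp_shift by trivial. field. split; trivial. apply qpoch_nz; lra. }
destruct (Cseries_fubini f
  (fun k => g k * x ^ k * qpoch (alpha * q) q (2 * k) * J k)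
  (Bg * Bw * (1 + Cmod alpha) * Ba * Cmod (/ (1 - alpha)) * Bq)
  (Cmod x)) as [L [H1 H2]].
- split; [apply Cmod_ge_0 | exact Hx].
- intros k m. rewrite Ef, !Cmod_mult, !Cmod_pow, Cmod_opp.
  assert (G0 := Cmod_ge_0 x).
  assert (Hpow : forall n, (0 <= Cmod q ^ n <= 1)%R).
  { intros n. rewrite <- Cmod_pow. split; [apply Cmod_ge_0 | apply Cmod_pow_le1; lra]. }
  assert (H1 : (Cmod (1 - alpha * q ^ (2 * (k + m))) <= 1 + Cmod alpha)%R).
  { unfold Cminus. eapply Rle_trans; [apply Cmod_triangle|].
    rewrite Cmod_1, Cmod_opp, Cmod_mult, Cmod_pow.
    specialize (Hpow (2 * (k + m))%nat). assert (Hm := Cmod_ge_0 alpha). nra. }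
  assert (Hk := pow_le _ k G0). assert (Hm := pow_le _ m G0).
  apply Rle_trans with (Bg * Cmod x ^ k * Cmod x ^ m * 1 * Bw * (1 + Cmod alpha)
     * Ba * Cmod (/ (1 - alpha)) * Bq)%R; [|apply Req_le; ring].
  repeat (apply Rmult_le_compat; [repeat apply Rmult_le_pos | | |]);
    try apply Cmod_ge_0; try apply Hpow; try apply pow_le, Cmod_ge_0;
    try apply Rle_refl; auto.
- intros k. apply Cseries_scal, HJ.
- exists L; split; [exact H1|].
  revert H2. apply is_series_ext. intros n.
  etransitivity; [|apply Csum_scal]. apply Csum_ext. intros k Hk.
  destruct (Nat.le_exists_sub k n Hk) as [m [-> _]].
  replace (m + k)%nat with (k + m)%nat by ring.
  replace (k + m - k)%nat with m by lia.
  rewrite Ef. unfold vwp.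
  replace (2 * k + m)%nat with ((k + m) + k)%nat by ring.
  rewrite (qpoch_add alpha q (k + m) k).
  (* The sign [(- (1)) ^ k] is isolated because [qpoch_reversal] consumes it. *)
  replace ((- x) ^ (k + m)) with (x ^ k * (- (1)) ^ k * (- x) ^ m).
  2:{ rewrite Cpow_add_r, <- Cpow_mult_l. do 2 f_equal. ring. }
  assert (Hm : qpoch q q m <> 0) by (apply qpoch_nz; lra).
  assert (Hkm : qpoch q q (k + m) <> 0) by (apply qpoch_nz; lra).
  transitivity (g k * x ^ k * (- x) ^ m * w (k + m)%nat
    * (1 - alpha * q ^ (2 * (k + m))) * qpoch alpha q (k + m)
    * qpoch (alpha * q ^ (k + m)) q k / (1 - alpha)
    * ((qpoch q q (k + m) * q ^ (m * (m - 1) / 2))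
       / (qpoch q q m * qpoch q q (k + m)))).
  + field. now repeat split.
  + rewrite <- qpoch_reversal by exact Hq0. field. now repeat split.
Qed.

(** * Summation formulas *)

(* The left-hand side is the recurrence in [m] satisfied by the closed form of
   [q_saalschutz]; its partial sums telescope to a multiple of
   [qpoch (/ q ^ m) q J], which vanishes for [J > m]. *)
Lemma q_saalschutz_telescope (q X P Q alpha : C) (m J : nat) :
  q <> 0 -> (Cmod q < 1)%R ->
  (Cmod (X * Q) < 1)%R -> (Cmod (X * P) < 1)%R -> alpha * q = X * P * Q ->
  sum_n (fun j => (1 - X * Q * q ^ m) * (1 - X * P * q ^ m)
      * (qpoch (/ q ^ S m) q j * qpoch (alpha * q ^ S m) q j
         * (qpoch X q j / (qpoch q q j * qpoch (X * Q) q j * qpoch (X * P) q j))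
         * q ^ j)
    - X * (1 - P * q ^ m) * (1 - Q * q ^ m)
      * (qpoch (/ q ^ m) q j * qpoch (alpha * q ^ m) q j
         * (qpoch X q j / (qpoch q q j * qpoch (X * Q) q j * qpoch (X * P) q j))
         * q ^ j)) J
  = (1 - X * P * Q * q ^ m * q ^ m) * qpoch (/ q ^ m) q J
    * qpoch (alpha * q ^ S m) q J * qpoch X q (S J)
    / (qpoch q q J * qpoch (X * Q) q J * qpoch (X * P) q J) :> C.
Proof.
intros Hq0 Hq HQ HP Ha.
replace alpha with (X * P * Q / q)
  by (rewrite <- Ha; field; exact Hq0). clear Ha.
assert (HM := Cpow_nz q m Hq0).
induction J as [|J IH].
- rewrite Csum_0. simpl. field; repeat split; try exact C1_nz; trivial.
- rewrite Csum_S, IH. clear IH.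
  (* Taking first factors off these two symbols leaves the bases [/ q ^ m] and [alpha * q ^ S m] in
     every term; what remains is a rational identity. *)
  rewrite (qpoch_S_l (/ q ^ S m)), (qpoch_S_l (X * P * Q / q * q ^ m)).
  rewrite (qpoch_S X q (S J)), !(qpoch_S X q J), !(qpoch_S _ q J), !Cpow_S.
  replace (/ (q * q ^ m) * q) with (/ q ^ m) by (field; now split).
  replace (X * P * Q / q * q ^ m * q) with (X * P * Q / q * (q * q ^ m)) by ring.
  assert (H1 : qpoch q q J <> 0) by (apply qpoch_nz; lra).
  assert (H2 : qpoch (X * Q) q J <> 0) by (apply qpoch_nz; lra).
  assert (H3 : qpoch (X * P) q J <> 0) by (apply qpoch_nz; lra).
  assert (HJ : (Cmod (q ^ J) <= 1)%R) by (apply Cmod_pow_le1; lra).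
  assert (H4 : 1 - q * q ^ J <> 0) by (apply one_minus_nz, Cmod_mult_lt1; lra).
  assert (H5 : 1 - X * Q * q ^ J <> 0) by (apply one_minus_nz, Cmod_mult_lt1; lra).
  assert (H6 : 1 - X * P * q ^ J <> 0) by (apply one_minus_nz, Cmod_mult_lt1; lra).
  field. now repeat split.
Qed.

(** The q-Pfaff-Saalschuetz sum; [alpha * q = X * P * Q] is the balancing condition. Telescoping up
    to [S m] has zero remainder and yields a first-order recurrence in [m]. *)
Lemma q_saalschutz (q X P Q alpha : C) (m : nat) :
  q <> 0 -> (Cmod q < 1)%R ->
  (Cmod (X * Q) < 1)%R -> (Cmod (X * P) < 1)%R -> alpha * q = X * P * Q ->
  sum_n (fun j => qpoch (/ q ^ m) q j * qpoch (alpha * q ^ m) q j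
         * (qpoch X q j / (qpoch q q j * qpoch (X * Q) q j * qpoch (X * P) q j))
         * q ^ j) m
  = X ^ m * qpoch P q m * qpoch Q q m / (qpoch (X * Q) q m * qpoch (X * P) q m)
  :> C.
Proof.
intros Hq0 Hq HQ HP Ha. induction m as [|m IH].
- rewrite Csum_0. simpl. field; repeat split; exact C1_nz.
- assert (T := q_saalschutz_telescope q X P Q alpha m (S m) Hq0 Hq HQ HP Ha).
  rewrite Csum_minus, !Csum_scal in T.
  (* The sum for [m] runs one index too far; its extra term vanishes together with the remainder. *)
  rewrite (Csum_S (fun j => qpoch (/ q ^ m) q j * _ * _ * _) m), IH in T.
  rewrite !(qpoch_inv_pow_0 q m Hq0) in T.
  assert (H2 : qpoch (X * Q) q m <> 0) by (apply qpoch_nz; lra).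
  assert (H3 : qpoch (X * P) q m <> 0) by (apply qpoch_nz; lra).
  assert (HJ : (Cmod (q ^ m) <= 1)%R) by (apply Cmod_pow_le1; lra).
  assert (H5 : 1 - X * Q * q ^ m <> 0) by (apply one_minus_nz, Cmod_mult_lt1; lra).
  assert (H6 : 1 - X * P * q ^ m <> 0) by (apply one_minus_nz, Cmod_mult_lt1; lra).
  apply (Cmult_cancel_l ((1 - X * Q * q ^ m) * (1 - X * P * q ^ m))).
  { now apply Cmult_neq_0. }
  match type of T with ?u - ?v = ?w => replace u with (w + v) by (rewrite <- T; ring) end.
  unfold Cdiv at 1 3. rewrite Cmult_0_r, !Cmult_0_l, Cplus_0_l, Cplus_0_r.
  rewrite !qpoch_S, Cpow_S. field. now repeat split.
Qed.

(* The summand of the very-well-poised 6-phi-5 with one parameter sent to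
   infinity. *)
Definition six_phi_five_term (q D E x : C) (m : nat) : C :=
  vwp (D * E * x / q) q m
  * (qpoch D q m * qpoch E q m / (qpoch (E * x) q m * qpoch (D * x) q m))
  * (- x) ^ m * q ^ (m * (m - 1) / 2).

(** The functional equation of the product in [six_phi_five] under [x -> x q], at the level of
    partial sums. The remainder carries [(- x) ^ K], so it disappears in the limit. *)
Lemma six_phi_five_telescope (q D E x : C) (K : nat) :
  q <> 0 -> (Cmod q < 1)%R ->
  (Cmod D < 1)%R -> (Cmod E < 1)%R -> (Cmod x < 1)%R -> D * E * x / q <> 1 ->
  sum_n (fun m => (1 - E * x) * (1 - D * x) * six_phi_five_term q D E x m
    - (1 - D * E * x) * (1 - x) * six_phi_five_term q D E (x * q) m) K
  = x * q ^ K * qpoch (D * E * x) q K * qpoch D q (S K) * qpoch E q (S K)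
    / (qpoch q q K * qpoch (E * x * q) q K * qpoch (D * x * q) q K)
    * (- x) ^ K * q ^ (K * (K - 1) / 2) :> C.
Proof.
intros Hq0 Hq HD HE Hx Ha.
assert (Hx' := Rlt_le _ _ Hx).
assert (HDx : (Cmod (D * x) < 1)%R) by now apply Cmod_mult_lt1.
assert (HEx : (Cmod (E * x) < 1)%R) by now apply Cmod_mult_lt1.
assert (HA : (Cmod (D * E * x) < 1)%R)
  by (apply Cmod_mult_lt1; trivial; apply Cmod_mult_lt1; lra).
assert (HDxq : (Cmod (D * x * q) < 1)%R) by (apply Cmod_mult_lt1; lra).
assert (HExq : (Cmod (E * x * q) < 1)%R) by (apply Cmod_mult_lt1; lra).
assert (Ha' : 1 - D * E * x / q <> 0) by now apply Cminus_nz.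
assert (Ha2 : q - D * E * x <> 0).
{ intros H. apply Ha'. replace (1 - D * E * x / q) with ((q - D * E * x) / q)
    by (field; exact Hq0). rewrite H. field. exact Hq0. }
assert (G0 := one_minus_nz _ HA). assert (G1 := one_minus_nz _ HDx).
assert (G2 := one_minus_nz _ HEx).
unfold six_phi_five_term, vwp.
induction K as [|K IH].
- rewrite Csum_0. simpl. field; repeat split; try exact C1_nz; trivial.
- rewrite Csum_S, IH. clear IH.
  (* Under [x -> x q] the base [alpha] becomes [alpha * q], so peeling first factors off the symbols
     in [x] brings both summands to common symbols. *)
  replace (D * E * (x * q) / q) with (D * E * x) by (field; exact Hq0).
  replace (E * (x * q)) with (E * x * q) by ring.
  replace (D * (x * q)) with (D * x * q) by ring.
  replace (- (x * q)) with (- x * q) by ring.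
  replace (2 * S K)%nat with (S K + S K)%nat by ring.
  rewrite triangular_S, !Cpow_add_r.
  rewrite Cpow_mult_l.
  rewrite (qpoch_S_l (D * E * x / q)), (qpoch_S_l (E * x)), (qpoch_S_l (D * x)).
  replace (D * E * x / q * q) with (D * E * x) by (field; exact Hq0).
  rewrite (qpoch_S D q (S K)), (qpoch_S E q (S K)).
  rewrite !(qpoch_S _ q K), !Cpow_S.
  assert (HJ : (Cmod (q ^ K) <= 1)%R) by (apply Cmod_pow_le1; lra).
  assert (N1 : qpoch q q K <> 0) by (apply qpoch_nz; lra).
  assert (N2 : qpoch (E * x * q) q K <> 0) by (apply qpoch_nz; lra).
  assert (N3 : qpoch (D * x * q) q K <> 0) by (apply qpoch_nz; lra).
  assert (N4 : 1 - q * q ^ K <> 0) by (apply one_minus_nz, Cmod_mult_lt1; lra).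
  assert (N5 : 1 - E * x * q * q ^ K <> 0) by (apply one_minus_nz, Cmod_mult_lt1; lra).
  assert (N6 : 1 - D * x * q * q ^ K <> 0) by (apply one_minus_nz, Cmod_mult_lt1; lra).
  field. now repeat split.
Qed.

(** Uniformity in [y] permits the limit along [x * q ^ N]; [K] controls the only denominator that
    may come close to 0, [1 - alpha]. *)
Lemma six_phi_five_bound (q D E : C) (rho K : R) :
  q <> 0 -> (Cmod q < 1)%R -> (Cmod D < 1)%R -> (Cmod E < 1)%R ->
  (0 <= rho < 1)%R ->
  exists B : R, forall y m, (Cmod y <= rho)%R -> D * E * y / q <> 1 ->
    (Cmod (/ (1 - D * E * y / q)) <= K)%R ->
    (Cmod (six_phi_five_term q D E y m) <= B * Cmod y ^ m)%R.
Proof.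
intros Hq0 Hq HD HE Hr.
assert (Gq := proj1 (Cmod_gt_0 q) Hq0).
(* A bound on [alpha = D * E * y / q]; it may exceed 1 because of the division by [q]. *)
set (A := (rho / Cmod q)%R).
assert (HA : (0 <= A)%R) by (apply Rle_mult_inv_pos; lra).
destruct (qpoch_bound q A Hq HA) as [B1 H1].
destruct (qpoch_inv_bound q rho Hq Hr) as [B2 H2].
destruct (bounded_qpoch_inv q q Hq Hq) as [B3 H3].
destruct (bounded_qpoch q D Hq) as [B4 H4].
destruct (bounded_qpoch q E Hq) as [B5 H5].
exists ((1 + A) * B1 * K * B3 * B4 * B5 * B2 * B2)%R.
intros y m Hy Ha HK. set (alpha := D * E * y / q) in *.
assert (GD := Cmod_ge_0 D). assert (GE := Cmod_ge_0 E). assert (Gy := Cmod_ge_0 y).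
assert (HDy : (Cmod (D * y) <= rho)%R) by (rewrite Cmod_mult; nra).
assert (HEy : (Cmod (E * y) <= rho)%R) by (rewrite Cmod_mult; nra).
assert (Halpha : (Cmod alpha <= A)%R).
{ unfold alpha, A. rewrite Cmod_div by exact Hq0.
  apply Rmult_le_compat_r; [left; now apply Rinv_0_lt_compat|].
  rewrite <- Cmult_assoc, Cmod_mult.
  assert (G := Cmod_ge_0 (E * y)). nra. }
assert (Hm : (Cmod (q ^ m) <= 1)%R) by (apply Cmod_pow_le1; lra).
assert (Ha' : 1 - alpha <> 0) by now apply Cminus_nz.
assert (Ed : six_phi_five_term q D E y m
  = (1 - alpha * q ^ (2 * m)) * qpoch alpha q m * / (1 - alpha) * / qpoch q q m
    * qpoch D q m * qpoch E q m * / qpoch (E * y) q m * / qpoch (D * y) q m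
    * (- y) ^ m * q ^ (m * (m - 1) / 2)).
{ unfold six_phi_five_term, vwp. fold alpha. field.
  repeat split; trivial; apply qpoch_nz; lra. }
rewrite Ed, !Cmod_mult, !Cmod_pow, Cmod_opp.
assert (Hpow : forall n, (0 <= Cmod q ^ n <= 1)%R).
{ intros n. rewrite <- Cmod_pow. split; [apply Cmod_ge_0 | apply Cmod_pow_le1; lra]. }
assert (H0 : (Cmod (1 - alpha * q ^ (2 * m)) <= 1 + A)%R).
{ unfold Cminus. eapply Rle_trans; [apply Cmod_triangle|].
  rewrite Cmod_1, Cmod_opp, Cmod_mult, Cmod_pow.
  specialize (Hpow (2 * m)%nat). assert (G := Cmod_ge_0 alpha). nra. }
apply Rle_trans with
  ((1 + A) * B1 * K * B3 * B4 * B5 * B2 * B2 * Cmod y ^ m * 1)%R;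
  [|apply Req_le; ring].
repeat (apply Rmult_le_compat; [repeat apply Rmult_le_pos | | |]);
  try apply Cmod_ge_0; try apply Hpow; try apply pow_le, Cmod_ge_0;
  try apply Rle_refl; auto.
Qed.

Lemma six_phi_five_ex (q D E x : C) :
  q <> 0 -> (Cmod q < 1)%R -> (Cmod D < 1)%R -> (Cmod E < 1)%R ->
  (Cmod x < 1)%R -> D * E * x / q <> 1 ->
  is_series (six_phi_five_term q D E x) (CSeries (six_phi_five_term q D E x)).
Proof.
intros Hq0 Hq HD HE Hx Ha.
destruct (six_phi_five_bound q D E (Cmod x) (Cmod (/ (1 - D * E * x / q)))
   Hq0 Hq HD HE (conj (Cmod_ge_0 x) Hx)) as [B HB].
destruct (Cseries_geom_bound (six_phi_five_term q D E x) B (Cmod x)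
   (conj (Cmod_ge_0 x) Hx)) as [l [Hl _]].
- intros n. apply HB; trivial; apply Rle_refl.
- now rewrite (CSeries_correct _ _ Hl).
Qed.

(** The limit of [six_phi_five_telescope]: its remainder is a bounded sequence times [(- x) ^ K]. *)
Lemma six_phi_five_step (q D E x S0 S1 : C) :
  q <> 0 -> (Cmod q < 1)%R -> (Cmod D < 1)%R -> (Cmod E < 1)%R ->
  (Cmod x < 1)%R -> D * E * x / q <> 1 ->
  is_series (six_phi_five_term q D E x) S0 ->
  is_series (six_phi_five_term q D E (x * q)) S1 ->
  (1 - E * x) * (1 - D * x) * S0 = (1 - D * E * x) * (1 - x) * S1.
Proof.
intros Hq0 Hq HD HE Hx Ha H0 H1.
assert (HDx : (Cmod (D * x * q) < 1)%R).
{ apply Cmod_mult_lt1; [|lra]. apply Cmod_mult_lt1; lra. }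
assert (HEx : (Cmod (E * x * q) < 1)%R).
{ apply Cmod_mult_lt1; [|lra]. apply Cmod_mult_lt1; lra. }
apply is_series_Cconv in H0. apply is_series_Cconv in H1.
set (c0 := (1 - E * x) * (1 - D * x)) in *.
set (c1 := (1 - D * E * x) * (1 - x)) in *.
set (T := fun K => sum_n (fun m => c0 * six_phi_five_term q D E x m
   - c1 * six_phi_five_term q D E (x * q) m) K : C).
assert (HT : Cconv T 0).
{ apply Cconv_ext with (fun K => (x * q ^ K * qpoch (D * E * x) q K
     * qpoch D q (S K) * qpoch E q (S K) * / qpoch q q K
     * / qpoch (E * x * q) q K * / qpoch (D * x * q) q K
     * q ^ (K * (K - 1) / 2)) * (- x) ^ K).
  - intros K. unfold T, c0, c1.
    rewrite six_phi_five_telescope by trivial. field.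
    repeat split; apply qpoch_nz; lra.
  - apply Cconv_bounded_geom; [|now rewrite Cmod_opp].
    repeat match goal with |- bounded (fun n => @?u n * @?v n) =>
      apply (bounded_mult u v) end;
      try (apply bounded_qpoch_inv; assumption);
      try (now apply bounded_qpoch); try apply bounded_const.
    + apply bounded_pow. lra.
    + apply (bounded_S (qpoch D q)). now apply bounded_qpoch.
    + apply (bounded_S (qpoch E q)). now apply bounded_qpoch.
    + exists 1%R. intros n. apply Cmod_pow_le1. lra. }
(* The scaled partial sums for [x] have two limits: their own, and, as [T] tends to 0, that of the
   scaled partial sums for [x * q]. *)
apply Cconv_unique with (fun K => c0 * sum_n (six_phi_five_term q D E x) K).
- apply Cconv_mult; [apply Cconv_const | exact H0].
- apply Cconv_squeeze with (fun K => (Cmod (T K - 0)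
     + Cmod (c1 * sum_n (six_phi_five_term q D E (x * q)) K - c1 * S1))%R).
  + intros K. eapply Rle_trans; [|apply Cmod_triangle]. apply Req_le. f_equal.
    unfold T. rewrite Csum_minus, !Csum_scal. ring.
  + replace (Finite 0) with (Finite (0 + 0)) by (f_equal; ring).
    apply is_lim_seq_plus'; [exact HT|].
    exact (Cconv_mult _ _ _ _ (Cconv_const c1) H1).
Qed.

(* The step [x -> x q] of the functional equation is iterated towards [x = 0],
   where the series reduces to its first term. *)
Lemma six_phi_five (q D E x : C) :
  q <> 0 -> (Cmod q < 1)%R -> (Cmod D < 1)%R -> (Cmod E < 1)%R ->
  (Cmod x < 1)%R -> D * E * x / q <> 1 ->
  is_series (six_phi_five_term q D E x)
    (qpoch_inf (D * E * x) q * qpoch_inf x q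
     / (qpoch_inf (E * x) q * qpoch_inf (D * x) q)).
Proof.
intros Hq0 Hq HD HE Hx Ha.
assert (HDx : (Cmod (D * x) < 1)%R) by (apply Cmod_mult_lt1; lra).
assert (HEx : (Cmod (E * x) < 1)%R) by (apply Cmod_mult_lt1; lra).
assert (HDE : (Cmod (D * E) < 1)%R) by (apply Cmod_mult_lt1; lra).
assert (HA : (Cmod (D * E * x) < 1)%R) by (apply Cmod_mult_lt1; lra).
assert (HpowS : forall N, D * E * (x * q ^ S N) / q = D * E * x * q ^ N).
{ intros N. rewrite Cpow_S. field. exact Hq0. }
assert (HAN : forall N, (Cmod (D * E * x * q ^ N) <= Cmod (D * E * x))%R).
{ intros N. rewrite Cmod_mult. assert (Cmod (q ^ N) <= 1)%R by (apply Cmod_pow_le1; lra).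
  assert (G := Cmod_ge_0 (D * E * x)). nra. }
assert (Hne : forall N, D * E * (x * q ^ N) / q <> 1).
{ intros [|N].
  - simpl. now rewrite Cmult_1_r.
  - rewrite HpowS. intros H. specialize (HAN N). rewrite H, Cmod_1 in HAN. lra. }
assert (HxN : forall N, (Cmod (x * q ^ N) <= Cmod x)%R).
{ intros N. rewrite Cmod_mult. assert (Cmod (q ^ N) <= 1)%R by (apply Cmod_pow_le1; lra).
  assert (G := Cmod_ge_0 x). nra. }
assert (HxN1 : forall N, (Cmod (x * q ^ N) < 1)%R)
  by (intros N; eapply Rle_lt_trans; [apply HxN | exact Hx]).
set (F := fun N => CSeries (six_phi_five_term q D E (x * q ^ N))).
assert (HF : forall N, is_series (six_phi_five_term q D E (x * q ^ N)) (F N))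
  by (intros N; now apply six_phi_five_ex).
assert (It : forall N, qpoch (E * x) q N * qpoch (D * x) q N * F 0%nat
                       = qpoch (D * E * x) q N * qpoch x q N * F N).
{ induction N as [|N IH]; [simpl; ring|].
  assert (St := six_phi_five_step q D E (x * q ^ N) (F N) (F (S N)) Hq0 Hq HD HE
                  (HxN1 N) (Hne N) (HF N)).
  replace (x * q ^ N * q) with (x * q ^ S N) in St by (rewrite Cpow_S; ring).
  specialize (St (HF (S N))). rewrite !qpoch_S.
  transitivity ((1 - E * (x * q ^ N)) * (1 - D * (x * q ^ N))
     * (qpoch (E * x) q N * qpoch (D * x) q N * F 0%nat)); [ring|].
  rewrite IH.
  transitivity (qpoch (D * E * x) q N * qpoch x q N
    * ((1 - E * (x * q ^ N)) * (1 - D * (x * q ^ N)) * F N)); [ring|].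
  rewrite St. ring. }
assert (HF1 : Cconv F 1).
(* At length 1 this bounds [/ (1 - u)] for [Cmod u <= Cmod (D * E * x)]. It applies to
   [x * q ^ S N], where [alpha] equals [D * E * x * q ^ N]; hence the shift of index below. *)
{ destruct (qpoch_inv_bound q (Cmod (D * E * x)) Hq (conj (Cmod_ge_0 _) HA))
    as [K HK].
  destruct (six_phi_five_bound q D E (Cmod x) K Hq0 Hq HD HE
    (conj (Cmod_ge_0 x) Hx)) as [B HB].
  apply is_lim_seq_incr_1.
  apply (Cconv_squeeze (fun N => F (S N)) 1
    (fun N => B * / (1 - Cmod x) * Cmod x * Cmod q * Cmod q ^ N)%R).
  - intros N. set (y := x * q ^ S N).
    assert (Hy : (0 <= Cmod y < 1)%R) by (split; [apply Cmod_ge_0 | apply HxN1]).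
    destruct (Cseries_geom_bound (six_phi_five_term q D E y) B (Cmod y) Hy)
      as [l [Hl Hb]].
    { intros n. apply HB; [apply HxN | apply Hne |].
      unfold y. rewrite HpowS. specialize (HK (D * E * x * q ^ N) 1%nat (HAN N)).
      simpl in HK. now rewrite Cmult_1_l, Cmult_1_r in HK. }
    rewrite (Cseries_unique _ _ _ (HF (S N)) Hl).
    assert (HB0 : (0 <= B)%R).
    { assert (G := HB y 0%nat (HxN _) (Hne _)). simpl in G.
      eapply Rle_trans; [apply Cmod_ge_0 |]. rewrite <- (Rmult_1_r B). apply G.
      unfold y. rewrite HpowS. specialize (HK (D * E * x * q ^ N) 1%nat (HAN N)).
      simpl in HK. now rewrite Cmult_1_l, Cmult_1_r in HK. }
    (* The zeroth term is 1, so the tail after it is the distance from [F (S N)] to 1, of order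
       [Cmod y]. *)
    specialize (Hb 0%nat). rewrite Csum_0 in Hb.
    replace (six_phi_five_term q D E y 0) with (RtoC 1) in Hb.
    2:{ unfold six_phi_five_term, vwp. simpl. field.
        assert (G := Cminus_nz _ _ (Hne (S N))). fold y in G.
        repeat split; try exact C1_nz; trivial.
        intros Z. apply G. replace (1 - D * E * y / q) with ((q - D * E * y) / q)
          by (field; exact Hq0). rewrite Z. field. exact Hq0. }
    eapply Rle_trans; [exact Hb|].
    rewrite !Rmult_assoc. apply Rmult_le_compat_l; [exact HB0|].
    apply Rmult_le_compat.
    + left; apply Rinv_0_lt_compat; lra.
    + apply pow_le; lra.
    + apply Rinv_le_contravar; [lra|]. assert (G := HxN (S N)). fold y in G. lra.
    + apply Req_le. unfold y. rewrite Cmod_mult, Cmod_pow. simpl. ring.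
  - replace 0%R with (B * / (1 - Cmod x) * Cmod x * Cmod q * 0)%R by ring.
    apply is_lim_seq_mult'; [apply is_lim_seq_const|].
    apply is_lim_seq_geom. rewrite Rabs_pos_eq; [exact Hq | apply Cmod_ge_0]. }
assert (E0 : qpoch_inf (E * x) q * qpoch_inf (D * x) q * F 0%nat
             = qpoch_inf (D * E * x) q * qpoch_inf x q * 1).
{ apply Cconv_unique with
    (fun N => qpoch (E * x) q N * qpoch (D * x) q N * F 0%nat).
  - apply Cconv_mult; [|apply Cconv_const].
    apply Cconv_mult; now apply qpoch_inf_conv.
  - apply (Cconv_ext (fun N => qpoch (D * E * x) q N * qpoch x q N * F N)).
    + intros N. now rewrite It.
    + apply Cconv_mult; [|exact HF1].
      apply Cconv_mult; now apply qpoch_inf_conv. }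
assert (N1 := qpoch_inf_nz q _ Hq HEx). assert (N2 := qpoch_inf_nz q _ Hq HDx).
replace (qpoch_inf (D * E * x) q * qpoch_inf x q
     / (qpoch_inf (E * x) q * qpoch_inf (D * x) q)) with (F 0%nat).
- specialize (HF 0%nat). simpl in HF. now rewrite Cmult_1_r in HF.
- apply (Cmult_cancel_l (qpoch_inf (E * x) q * qpoch_inf (D * x) q)).
  + now apply Cmult_neq_0.
  + rewrite E0. field. now split.
Qed.

(** * The transformation *)

(** [alpha] may leave the unit disc, but [alpha * q] and its multiples by powers of [q] stay inside;
    the case [k = 0] is the assumption. *)
Lemma alpha_pow_neq_1 (q alpha : C) (k : nat) :
  (Cmod q < 1)%R -> (Cmod (alpha * q) < 1)%R -> alpha <> 1 ->
  alpha * q ^ (2 * k) <> 1.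
Proof.
intros Hq Ha H1. destruct k as [|k].
- simpl. now rewrite Cmult_1_r.
- replace (2 * S k)%nat with (S (2 * k + 1)) by lia. rewrite Cpow_S, Cmult_assoc.
  intros H. assert (K : (Cmod (alpha * q * q ^ (2 * k + 1)) < 1)%R).
  { apply Cmod_mult_lt1; [exact Ha | apply Cmod_pow_le1; lra]. }
  rewrite H, Cmod_1 in K. lra.
Qed.

(* The nonterminating limit case of Watson's transformation of a very-well-poised
   8-phi-7 into a balanced 4-phi-3. *)
Lemma watson_limit (q a b c d r alpha : C) :
  q <> 0 -> (Cmod q < 1)%R ->
  (Cmod a < 1)%R -> (Cmod b < 1)%R -> (Cmod c < 1)%R ->
  (Cmod d < 1)%R -> (Cmod r < 1)%R ->
  alpha * q = a ^ 2 * b * c * d * r -> alpha <> 1 ->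
  is_series (fun n => vwp alpha q n
      * (qpoch (a * b) q n * qpoch (a * c) q n * qpoch (a * d) q n
         * qpoch (a * r) q n
         / (qpoch (a * b * c * d) q n * qpoch (a * b * c * r) q n
            * qpoch (a * b * d * r) q n * qpoch (a * c * d * r) q n))
      * (- (b * c * d * r)) ^ n * q ^ (n * (n - 1) / 2))
    (qpoch_inf (d * r) q * qpoch_inf (alpha * q) q
     / (qpoch_inf (a * b * d * r) q * qpoch_inf (a * c * d * r) q)
     * qhyp [a * b; a * c; b * c] [a * b * c * d; a * b * c * r] q (d * r)).
Proof.
intros Hq0 Hq Ha Hb Hc Hd Hr Hal Hal1.
assert (Hab : (Cmod (a * b) < 1)%R) by (apply Cmod_mult_lt1; lra).
assert (Hac : (Cmod (a * c) < 1)%R) by (apply Cmod_mult_lt1; lra).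
assert (Hdr : (Cmod (d * r) < 1)%R) by (apply Cmod_mult_lt1; lra).
assert (Habdr : (Cmod (a * b * d * r) < 1)%R) by (repeat (apply Cmod_mult_lt1; try lra)).
assert (Hacdr : (Cmod (a * c * d * r) < 1)%R) by (repeat (apply Cmod_mult_lt1; try lra)).
assert (Habcd : (Cmod (a * b * c * d) < 1)%R) by (repeat (apply Cmod_mult_lt1; try lra)).
assert (Habcr : (Cmod (a * b * c * r) < 1)%R) by (repeat (apply Cmod_mult_lt1; try lra)).
assert (Halq : (Cmod (alpha * q) < 1)%R).
{ rewrite Hal. replace (a ^ 2 * b * c * d * r) with (a * (a * b * c * d) * r)
    by (simpl; ring). repeat (apply Cmod_mult_lt1; try lra). }
assert (Halk : forall k, alpha * q ^ (2 * k) <> 1) by (intros; now apply alpha_pow_neq_1).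
set (const := qpoch_inf (d * r) q * qpoch_inf (alpha * q) q
     / (qpoch_inf (a * b * d * r) q * qpoch_inf (a * c * d * r) q)).
set (w := fun n => qpoch (a * b) q n * qpoch (a * c) q n
   / (qpoch (a * b * d * r) q n * qpoch (a * c * d * r) q n)).
(* The coefficients of [q_saalschutz] with [X = b * c], [P = a * d], [Q = a * r]. *)
set (g := fun n => qpoch (b * c) q n / (qpoch q q n
   * qpoch (b * c * (a * r)) q n * qpoch (b * c * (a * d)) q n)).
(* The value of [six_phi_five] at [D = a * b * q ^ k], [E = a * c * q ^ k], [x = d * r], times the
   part of [w (k + m)] independent of [m]. *)
set (J := fun k => w k
  * (qpoch_inf (alpha * q * q ^ (2 * k)) q * qpoch_inf (d * r) q
     / (qpoch_inf (a * c * d * r * q ^ k) q * qpoch_inf (a * b * d * r * q ^ k) q))).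
assert (Eabcr : b * c * (a * r) = a * b * c * r) by ring.
assert (Eabcd : b * c * (a * d) = a * b * c * d) by ring.
assert (Npoch : forall u n, (Cmod u < 1)%R -> qpoch u q n <> 0)
  by (intros; apply qpoch_nz; lra).
assert (Hpow : forall k, (Cmod (q ^ k) <= 1)%R) by (intros; apply Cmod_pow_le1; lra).
destruct (bailey_transform q alpha (d * r) w g J) as [L [HL1 HL2]]; trivial.
- unfold w. apply (bounded_ext (fun n => qpoch (a * b) q n * qpoch (a * c) q n
     * / qpoch (a * b * d * r) q n * / qpoch (a * c * d * r) q n)).
  + intros n. field. split; now apply Npoch.
  + repeat apply bounded_mult; try (now apply bounded_qpoch);
      now apply bounded_qpoch_inv.
- unfold g. rewrite Eabcr, Eabcd.
  apply (bounded_ext (fun n => qpoch (b * c) q n * / qpoch q q n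
     * / qpoch (a * b * c * r) q n * / qpoch (a * b * c * d) q n)).
  + intros n. field. repeat split; now apply Npoch.
  + repeat apply bounded_mult; try (now apply bounded_qpoch);
      now apply bounded_qpoch_inv.
- intros k.
  assert (Ek : a * b * q ^ k * (a * c * q ^ k) * (d * r) = alpha * q * q ^ (2 * k)).
  { rewrite Hal. replace (2 * k)%nat with (k + k)%nat by lia.
    rewrite Cpow_add_r. simpl. ring. }
  assert (Ekq : a * b * q ^ k * (a * c * q ^ k) * (d * r) / q = alpha * q ^ (2 * k)).
  { rewrite Ek. field. exact Hq0. }
  assert (S5 := six_phi_five q (a * b * q ^ k) (a * c * q ^ k) (d * r) Hq0 Hq).
  unfold six_phi_five_term in S5. rewrite Ekq, Ek in S5.
  replace (a * c * q ^ k * (d * r)) with (a * c * d * r * q ^ k) in S5 by ring.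
  replace (a * b * q ^ k * (d * r)) with (a * b * d * r * q ^ k) in S5 by ring.
  apply Cseries_ext with
    (2 := Cseries_scal (w k) _ _ (S5 (Cmod_mult_lt1 _ _ Hab (Hpow k))
       (Cmod_mult_lt1 _ _ Hac (Hpow k)) Hdr (Halk k))).
  intros m. unfold w. rewrite !qpoch_add. field.
  repeat split; apply Npoch; trivial; now apply Cmod_mult_lt1.
- assert (Hconst : const <> 0).
  { unfold const. apply Cmult_neq_0; [apply Cmult_neq_0; now apply qpoch_inf_nz|].
    apply Cinv_nz. apply Cmult_neq_0; now apply qpoch_inf_nz. }
  assert (E : is_series (fun k => const * qhyp_term [a * b; a * c; b * c]
     [a * b * c * d; a * b * c * r] q (d * r) k) L).
  { revert HL1. apply Cseries_ext. intros k.
    unfold qhyp_term, qpochs, J, g, w, const. simpl fold_right.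
    rewrite Eabcr, Eabcd.
    (* The finite symbols recombine with the shifted infinite products into products independent of
       [k]. *)
    rewrite (qpoch_inf_shift q (alpha * q) (2 * k) Hq).
    rewrite (qpoch_inf_shift q (a * b * d * r) k Hq).
    rewrite (qpoch_inf_shift q (a * c * d * r) k Hq).
    field. repeat split; try (now apply Npoch);
      (apply qpoch_inf_nz; [exact Hq|]; now apply Cmod_mult_lt1). }
  replace (const * qhyp _ _ _ _) with L.
  + revert HL2. apply Cseries_ext. intros n.
    (* The inner sum supplies the missing symbols and [(b * c) ^ n], which turns the argument
       [d * r] into [b * c * d * r]. *)
    assert (Sa := q_saalschutz q (b * c) (a * d) (a * r) alpha n Hq0 Hq).
    rewrite Eabcr, Eabcd in Sa. specialize (Sa Habcr Habcd).
    unfold g. rewrite Eabcr, Eabcd, Sa by (rewrite Hal; simpl; ring).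
    unfold w.
    replace (- (b * c * d * r)) with (b * c * (- (d * r))) by ring.
    rewrite (Cpow_mult_l (b * c)). field.
    repeat split; now apply Npoch.
  (* Dividing by the nonzero [const] also gives the convergence of the 3-phi-2, without which
     [CSeries] would say nothing. *)
  + assert (E' := Cseries_scal (/ const) _ _ E).
    apply (Cmult_cancel_l (/ const)); [now apply Cinv_nz|].
    rewrite Cmult_assoc, Cinv_l, Cmult_1_l by exact Hconst.
    symmetry. unfold qhyp. apply CSeries_correct.
    revert E'. apply Cseries_ext. intros k. field. exact Hconst.
Qed.

Theorem theorem1p10 (q : R) (a b c d r s t h z beta delta alpha : C)
  (hq : (0 < q < 1)%R)
  (ha : (Cmod a < 1)%R) (hb : (Cmod b < 1)%R) (hc : (Cmod c < 1)%R)
  (hd : (Cmod d < 1)%R) (hr : (Cmod r < 1)%R) (hs : (Cmod s < 1)%R)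
  (ht : (Cmod t < 1)%R) (hh : (Cmod h < 1)%R)
  (halpha : alpha = a ^ 2 * b * c * d * r / q)
  (halpha1 : alpha <> 1)
  (hz : (Cmod z < 1)%R \/
        (Cmod z = 1%R /\
         ex_series (fun n : nat =>
           Cmod (rhs_term q a b c d r s t h z beta delta alpha n)))) :
  exists L : C,
    is_series (rhs_term q a b c d r s t h z beta delta alpha) L /\
    is_series (lhs_term q a b c d r s t h z beta delta)
      (qpochs_inf [a * b * d * r; a * c * d * r] q
         / qpochs_inf [d * r; q * alpha] q * L).
Proof.
assert (hz1 : (Cmod z <= 1)%R) by (destruct hz as [H|[H _]]; lra). clear hz.
assert (Hq0 : RtoC q <> 0) by (intros E; apply RtoC_inj in E; lra).
assert (Hq : (Cmod q < 1)%R) by (rewrite Cmod_R, Rabs_pos_eq; lra).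
assert (Hal : alpha * q = a ^ 2 * b * c * d * r) by (rewrite halpha; field; exact Hq0).
clear hq halpha. revert Hq0 Hq Hal. generalize (RtoC q). clear q.
intros q Hq0 Hq Hal.
assert (Hdr : (Cmod (d * r) < 1)%R) by (apply Cmod_mult_lt1; lra).
assert (Hx : (Cmod (b * c * d * r) < 1)%R) by (repeat (apply Cmod_mult_lt1; try lra)).
assert (Habdr : (Cmod (a * b * d * r) < 1)%R) by (repeat (apply Cmod_mult_lt1; try lra)).
assert (Hacdr : (Cmod (a * c * d * r) < 1)%R) by (repeat (apply Cmod_mult_lt1; try lra)).
assert (Habcd : (Cmod (a * b * c * d) < 1)%R) by (repeat (apply Cmod_mult_lt1; try lra)).
assert (Habcr : (Cmod (a * b * c * r) < 1)%R) by (repeat (apply Cmod_mult_lt1; try lra)).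
assert (Halq : (Cmod (alpha * q) < 1)%R).
{ rewrite Hal. replace (a ^ 2 * b * c * d * r) with (a * (a * b * c * d) * r)
    by (simpl; ring). repeat (apply Cmod_mult_lt1; try lra). }
assert (Halk : forall k, alpha * q ^ (2 * k) <> 1) by (intros; now apply alpha_pow_neq_1).
assert (Npoch : forall u n, (Cmod u < 1)%R -> qpoch u q n <> 0)
  by (intros; apply qpoch_nz; lra).
assert (Hpow : forall k, (Cmod (q ^ k) <= 1)%R) by (intros; apply Cmod_pow_le1; lra).
set (w := fun n => qpoch (a * b) q n * qpoch (a * c) q n * qpoch (a * d) q n
         * qpoch (a * r) q n
         / (qpoch (a * b * c * d) q n * qpoch (a * b * c * r) q n
            * qpoch (a * b * d * r) q n * qpoch (a * c * d * r) q n)).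
(* The 4-phi-3 coefficients, without the two symbols that depend on [n] and without [q ^ k], all
   supplied by [bailey_transform]. They are bounded because [Cmod z <= 1]. *)
set (g := fun n => qpoch beta q n * qpoch delta q n * z ^ n
   / (qpoch q q n * qpoch s q n * qpoch t q n * qpoch h q n)).
(* [w k] times the value of [watson_limit] at [a * q ^ k], for which [alpha] becomes
   [alpha * q ^ (2 * k)]. *)
set (J := fun k => w k
  * (qpoch_inf (d * r) q * qpoch_inf (alpha * q * q ^ (2 * k)) q
     / (qpoch_inf (a * b * d * r * q ^ k) q * qpoch_inf (a * c * d * r * q ^ k) q)
     * qhyp [a * b * q ^ k; a * c * q ^ k; b * c]
            [a * b * c * d * q ^ k; a * b * c * r * q ^ k] q (d * r))).
destruct (bailey_transform q alpha (b * c * d * r) w g J) as [L [HL1 HL2]]; trivial.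
- unfold w. apply (bounded_ext (fun n => qpoch (a * b) q n * qpoch (a * c) q n
     * qpoch (a * d) q n * qpoch (a * r) q n
     * / qpoch (a * b * c * d) q n * / qpoch (a * b * c * r) q n
     * / qpoch (a * b * d * r) q n * / qpoch (a * c * d * r) q n)).
  + intros n. field. repeat split; now apply Npoch.
  + repeat apply bounded_mult; try (now apply bounded_qpoch);
      now apply bounded_qpoch_inv.
- unfold g. apply (bounded_ext (fun n => qpoch beta q n * qpoch delta q n * z ^ n
     * / qpoch q q n * / qpoch s q n * / qpoch t q n * / qpoch h q n)).
  + intros n. field. repeat split; now apply Npoch.
  + repeat apply bounded_mult; try (now apply bounded_qpoch);
      try (now apply bounded_qpoch_inv). now apply bounded_pow.
- intros k.
  assert (Ha' : (Cmod (a * q ^ k) < 1)%R) by now apply Cmod_mult_lt1.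
  assert (W := watson_limit q (a * q ^ k) b c d r (alpha * q ^ (2 * k)) Hq0 Hq
                 Ha' hb hc hd hr).
  replace (a * q ^ k * b) with (a * b * q ^ k) in W by ring.
  replace (a * q ^ k * c) with (a * c * q ^ k) in W by ring.
  replace (a * q ^ k * d) with (a * d * q ^ k) in W by ring.
  replace (a * q ^ k * r) with (a * r * q ^ k) in W by ring.
  replace (a * b * q ^ k * c * d) with (a * b * c * d * q ^ k) in W by ring.
  replace (a * b * q ^ k * c * r) with (a * b * c * r * q ^ k) in W by ring.
  replace (a * b * q ^ k * d * r) with (a * b * d * r * q ^ k) in W by ring.
  replace (a * c * q ^ k * d * r) with (a * c * d * r * q ^ k) in W by ring.
  replace (alpha * q ^ (2 * k) * q) with (alpha * q * q ^ (2 * k)) in W by ring.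
  assert (Hal' : alpha * q * q ^ (2 * k) = (a * q ^ k) ^ 2 * b * c * d * r).
  { rewrite Hal. replace (2 * k)%nat with (k + k)%nat by lia.
    rewrite Cpow_add_r. simpl. ring. }
  apply Cseries_ext with
    (2 := Cseries_scal (w k) _ _ (W Hal' (Halk k))).
  intros m. unfold w. rewrite !qpoch_add. field.
  repeat split; apply Npoch; trivial; now apply Cmod_mult_lt1.
- exists L; split.
  + revert HL2. apply Cseries_ext. intros n.
    (* The 4-phi-3 terminates at [k = n], so its total sum is the finite sum of the interchange. *)
    assert (E : qhyp [/ q ^ n; alpha * q ^ n; beta; delta] [s; t; h] q (q * z)
      = sum_n (fun k => qpoch (/ q ^ n) q k * qpoch (alpha * q ^ n) q k
                        * g k * q ^ k) n).
    { unfold qhyp. rewrite (CSeries_finite _ n).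
      - apply Csum_ext. intros k _. unfold qhyp_term, qpochs, g. simpl fold_right.
        rewrite Cpow_mult_l. field. repeat split; now apply Npoch.
      - intros k Hk. unfold qhyp_term, qpochs. simpl fold_right.
        rewrite qpoch_inv_pow_eq0 by trivial. unfold Cdiv. ring. }
    unfold rhs_term. rewrite E. unfold vwp, w, qpochs. simpl fold_right.
    assert (H1 : 1 - alpha <> 0) by now apply Cminus_nz.
    field. repeat split; trivial; now apply Npoch.
  + unfold qpochs_inf. simpl fold_right. rewrite (Cmult_comm q alpha).
    (* The prefactor cancels the infinite products of [J], once these are written as full products
       over finite symbols; the factors [1] come from [fold_right]. *)
    apply Cseries_ext with
      (2 := Cseries_scal (qpoch_inf (a * b * d * r) q
         * (qpoch_inf (a * c * d * r) q * 1)
         / (qpoch_inf (d * r) q * (qpoch_inf (alpha * q) q * 1))) _ _ HL1).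
    intros k. unfold lhs_term, g, J, w, qpochs. simpl fold_right.
    rewrite (Cpow_mult_l (b * c * d * r) z).
    rewrite (qpoch_inf_shift q (alpha * q) (2 * k) Hq).
    rewrite (qpoch_inf_shift q (a * b * d * r) k Hq).
    rewrite (qpoch_inf_shift q (a * c * d * r) k Hq).
    field. repeat split; try (now apply Npoch); apply qpoch_inf_nz; trivial;
      now apply Cmod_mult_lt1.
Qed.
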